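(* Let $t=0$, $n\ge3$ and $1<\ell<n$. Consider the mTAZRP of type $\lambda$ on $n$ sites with parameters $x_1,\dots,x_n>0$, started at time $0$ from any configuration in which sites $\ell+1,\dots,n$ are empty. Then the law of the path $(W_s|_{[\ell]})_{s>0}$, where $W_s|_{[\ell]}=(W_s(1),\dots,W_s(\ell))$ is the configuration restricted to sites $1,\dots,\ell$, is unchanged when the parameters $x_{\ell+1},\dots,x_n$ are permuted (keeping $x_1,\dots,x_\ell$ fixed).
   Context: mTAZRP at $t=0$: for a partition $\lambda$, sites $1,\dots,n$ on a ring (site $n+1$ is site $1$); a configuration assigns to each site a multiset of species so that the union is the multiset of parts of $\lambda$ (larger label = stronger). With $t=0$, each nonempty site $j$, independently, at rate $x_j^{-1}$ sends one particle of the largest species present at $j$ to site $j+1$; empty sites do nothing. *)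

(* Defs.v *)
From HB Require Import structures.
From mathcomp Require Import all_boot all_order all_algebra all_fingroup.
From mathcomp Require Import all_classical all_reals all_analysis.
Set Implicit Arguments. Unset Strict Implicit. Unset Printing Implicit Defensive.
Import Order.TTheory GRing.Theory Num.Theory.
Local Open Scope ring_scope.

Definition is_partition (lam : seq nat) : bool :=
  sorted geq lam && all (fun p => 0 < p)%N lam.

(* Species are labelled 0 .. nspec lam - 1 (only labels that are parts of lam
   actually occur); multiplicities of a species are at most size lam. *)
Definition nspec (lam : seq nat) : nat := (\max_(p <- lam) p).+1.

(* A configuration on n sites (site i : 'I_n is site i+1 of the paper):
   for each site, the multiset of species present, given by its counts. *)
Definition config (n : nat) (lam : seq nat) : finType :=
  {ffun 'I_n -> {ffun 'I_(nspec lam) -> 'I_(size lam).+1}}.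

Definition valid_config n lam (w : config n lam) : bool :=
  [forall a : 'I_(nspec lam), (\sum_(i < n) (w i a : nat))%N == count_mem (a : nat) lam].

Definition site_nonempty n lam (w : config n lam) (j : 'I_n) : bool :=
  [exists a, (w j a : nat) != 0%N].

Definition top_species n lam (w : config n lam) (j : 'I_n) : nat :=
  (\max_(a : 'I_(nspec lam) | (w j a : nat) != 0%N) (a : nat))%N.

Definition move n lam (w : config n lam) (j : 'I_n) : config n lam :=
  [ffun i => [ffun a : 'I_(nspec lam) =>
     if (i == j) && ((a : nat) == top_species w j) then inord (w i a).-1
     else if (i == ordS j) && ((a : nat) == top_species w j) then inord (w i a).+1
     else w i a]].

Definition gen (R : realType) n lam (x : 'I_n -> R) (w w' : config n lam) : R :=
  \sum_(j < n | site_nonempty w j)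
     (x j)^-1 * ((move w j == w')%:R - (w == w')%:R).

Fixpoint gen_pow (R : realType) n lam (x : 'I_n -> R) (k : nat)
    (w w' : config n lam) : R :=
  match k with
  | 0%N => (w == w')%:R
  | k'.+1 => \sum_(v : config n lam) gen x w v * gen_pow x k' v w'
  end.

Definition trans (R : realType) n lam (x : 'I_n -> R) (s : R)
    (w w' : config n lam) : R :=
  limn (fun N => \sum_(k < N) (s ^+ k / (k`!)%:R) * gen_pow x k w w').

Definition restrict n lam (l : nat) (w : config n lam) : config n lam :=
  [ffun i : 'I_n => if (i < l)%N then w i else [ffun => ord0]].

(* Finite-dimensional distributions of the restricted path:
   with time gaps ds = [d_1; ...; d_k] (times s_m = d_1 + ... + d_m) and
   targets ys = [y_1; ...; y_k],
   fdd = P_{w0}( restrict W_{s_1} = y_1, ..., restrict W_{s_k} = y_k ). *)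
Fixpoint fdd (R : realType) n lam (x : 'I_n -> R) (l : nat)
    (ds : seq R) (ys : seq (config n lam)) (w0 : config n lam) : R :=
  match ds, ys with
  | d :: ds', y :: ys' =>
      \sum_(w : config n lam | restrict l w == y)
         trans x d w0 w * fdd x l ds' ys' w
  | _, _ => 1
  end.

(* Main.v *)
(* It suffices to exchange the parameters of two adjacent sites p and q = p + 1
   outside the observed window, both initially empty. Let a = 1/x_p, b = 1/x_q,
   r = a/b, and let Lambda be the kernel which, when q carries k particles, keeps the
   strongest min(k, G) of them at q and sends the others back to p, where G is
   geometric, P(G >= j) = r^j. Then L' Lambda = Lambda L for the generators L, L' of
   the original and exchanged dynamics (only this algebraic identity matters, so r > 1
   is harmless). Lambda does not touch the observed sites and acts trivially
   at configurations in which q is empty, so it carries one family of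
   finite-dimensional distributions to the other.

   Sorting the species, a site is described by the numbers cum a of its particles of
   species >= a. A jump changes these by 1 exactly where they are positive, and
   keeping the j strongest particles replaces cum a by min(j, cum a), so that all the
   commutation relations between jumps and Lambda reduce to linear arithmetic. *)
Require Import Defs.
From HB Require Import structures.
From mathcomp Require Import all_boot all_order all_algebra all_fingroup.
From mathcomp Require Import all_classical all_reals all_analysis.
From mathcomp Require Import zify ring.
Import Order.TTheory GRing.Theory Num.Theory.
Import numFieldNormedType.Exports.
Local Open Scope ring_scope.

(** * Cumulative counts *)

Definition cum {n lam} (w : config n lam) (i : 'I_n) (a : nat) : nat :=
  (\sum_(b : 'I_(nspec lam) | (a <= b)%N) (w i b : nat))%N.

Lemma cum_rec {n lam} (w : config n lam) i (a : 'I_(nspec lam)) :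
  cum w i a = (w i a + cum w i a.+1)%N.
Proof.
rewrite /cum (bigD1 a) //=; congr (_ + _)%N; apply: eq_bigl => b.
by rewrite ltn_neqAle andbC eq_sym.
Qed.

(** Successive differences of the cumulative counts recover the counts. All the commutation
    relations below are checked through this, in coordinates where [top_species] no longer
    appears. *)
Lemma cum_inj {n lam} (w w' : config n lam) :
  (forall i a, cum w i a = cum w' i a) -> w = w'.
Proof.
move=> e; apply/ffunP => i; apply/ffunP => a; apply/val_inj => /=.
by have := cum_rec w i a; have := cum_rec w' i a; rewrite !e => -> /addIn.
Qed.

(** Since [F] is nonincreasing, the natural-number differences never truncate and their tail sums
    telescope. This computes [cum] for a configuration defined by such differences, as [regroup]
    is. *)
Lemma cum_telescope {n lam} (w : config n lam) i (F : nat -> nat) :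
  {homo F : a b / (a <= b)%N >-> (b <= a)%N} ->
  F (nspec lam) = 0%N ->
  (forall a, (w i a : nat) = F a - F a.+1)%N ->
  forall a, (a <= nspec lam)%N -> cum w i a = F a.
Proof.
move=> Fh F0 wF a; rewrite leq_eqVlt => /orP[/eqP ->|].
  by rewrite F0 /cum big_pred0 // => b; apply/negbTE; rewrite -ltnNge.
move/ltnW/subnKC; move: (_ - a)%N => k.
elim: k a => [|k IH] a.
  rewrite addn0 => ->.
  by rewrite F0 /cum big_pred0 // => b; apply/negbTE; rewrite -ltnNge.
rewrite addnS => ak.
have al : (a < nspec lam)%N by rewrite -ak ltnS leq_addr.
have /= -> := cum_rec w i (Ordinal al).
rewrite IH ?addSn // wF subnK //; exact: Fh.
Qed.

Lemma cum_big {n lam} (w : config n lam) i a : (nspec lam <= a)%N -> cum w i a = 0%N.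
Proof.
move=> h; rewrite /cum big_pred0 // => b; apply/negbTE; rewrite -ltnNge.
exact: leq_trans h.
Qed.

Lemma cum_gt0 {n lam} (w : config n lam) i a :
  (0 < cum w i a)%N = [exists b : 'I_(nspec lam), (a <= b)%N && ((w i b : nat) != 0%N)].
Proof.
rewrite lt0n /cum sum_nat_eq0 negb_forall; apply: eq_existsb => b.
by rewrite negb_imply.
Qed.

Lemma nonempty_cum {n lam} (w : config n lam) i : site_nonempty w i = (0 < cum w i 0)%N.
Proof. by rewrite cum_gt0. Qed.

(** This is what eliminates [top_species]: the particle that leaves [i] is counted by [cum w i a]
    exactly when that number is positive. *)
Lemma le_top {n lam} (w : config n lam) i a : site_nonempty w i ->
  (a <= top_species w i)%N = (0 < cum w i a)%N.
Proof.
move=> ne; rewrite cum_gt0 /top_species.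
apply/idP/existsP => [|[b /andP[ab wb]]]; last first.
  apply: leq_trans ab _.
  exact: (@leq_bigmax_cond _ (fun a => (w i a : nat) != 0%N) (fun a => a : nat) b wb).
case/existsP: ne => c wc.
by case: (@eq_bigmax_cond _ (fun a => (w i a : nat) != 0%N) (fun a => a : nat));
  [apply/card_gt0P; exists c | move=> b wb -> ab; exists b; rewrite ab].
Qed.

Lemma top_lt {n lam} (w : config n lam) i : (top_species w i < nspec lam)%N.
Proof. by rewrite /top_species ltnS; apply/bigmax_leqP => b _; rewrite -ltnS. Qed.

(** Used to show that the [inord] in [move] and [regroup] never overflows. *)
Lemma valid_le {n lam} (w : config n lam) (i j : 'I_n) a : valid_config w -> i != j ->
  (w i a + w j a <= size lam)%N.
Proof.
move=> /forallP/(_ a)/eqP e ij; apply: leq_trans (count_size (pred1 (a : nat)) lam).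
rewrite -e (bigD1 i) //= leq_add2l (bigD1 j) ?(eq_sym j) //=.
exact: leq_addr.
Qed.

Lemma valid_cum {n lam} (w w' : config n lam) :
  (forall a, \sum_i cum w i a = \sum_i cum w' i a)%N -> valid_config w -> valid_config w'.
Proof.
move=> e /forallP v; apply/forallP => a; rewrite -(eqP (v a)); apply/eqP.
apply: (@addIn (\sum_i cum w' i a.+1)%N); rewrite -{2}e -!big_split /=.
by under eq_bigr do rewrite -cum_rec; under [RHS]eq_bigr do rewrite -cum_rec.
Qed.

(** * Effect of a jump on counts and cumulative counts *)

Lemma ordS_neq {n} (i : 'I_n) : (1 < n)%N -> ordS i != i.
Proof.
move=> n1; apply/eqP => /(congr1 val) /=.
have := ltn_ord i; rewrite leq_eqVlt => /orP[/eqP e|h].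
  by rewrite e modnn => i0; move: e; rewrite -i0 => n0; rewrite -n0 in n1.
by rewrite modn_small //; lia.
Qed.

(** The balance is written additively to avoid truncated subtraction. *)
Lemma move_count {n lam} (w : config n lam) j i b : (1 < n)%N -> valid_config w ->
  site_nonempty w j ->
  (move w j i b + ((i == j) && ((b : nat) == top_species w j)) =
   w i b + ((i == ordS j) && ((b : nat) == top_species w j)))%N.
Proof.
move=> n1 vw ne; rewrite !ffunE.
have Sj := ordS_neq j n1.
(* The top species does occur at [j], because nothing at [j] lies above it; hence the predecessor
   taken in [move] is a true decrement. *)
have w0 : (b : nat) = top_species w j -> (0 < w j b)%N.
  move=> e; have := le_top w j b ne; rewrite {1}e leqnn cum_rec.
  have -> : cum w j b.+1 = 0%N.
    by apply/eqP; rewrite -leqn0 leqNgt -(le_top _ _ _ ne) e ltnn.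
  by rewrite addn0 => <-.
case: (eqVneq (b : nat) (top_species w j)) => [e|_]; last by rewrite !andbF.
have {}w0 := w0 e; rewrite !andbT.
case: eqVneq => [->|ij].
  rewrite eq_sym (negbTE Sj) inordK; first by lia.
  by have := ltn_ord (w j b); lia.
case: eqVneq => [ei|]; last by [].
rewrite inordK ?addn0 ?addn1 // ltnS ei.
by have := valid_le w _ _ b vw Sj; lia.
Qed.

Lemma cum_move {n lam} (w : config n lam) j i a : (1 < n)%N -> valid_config w ->
  site_nonempty w j ->
  (cum (move w j) i a + (i == j) * (0 < cum w j a) =
   cum w i a + (i == ordS j) * (0 < cum w j a))%N.
Proof.
move=> n1 vw ne.
(* At most one [b] contributes to the right-hand sum, the top species, and only if it is at least
   [a]; by [le_top] this is the indicator on the left. *)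
have E (c : bool) : (c * (0 < cum w j a) =
    \sum_(b : 'I_(nspec lam) | (a <= b)%N) (c && ((b : nat) == top_species w j)))%N.
  rewrite -le_top //; case: c; last by rewrite big1.
  case: leqP => h; rewrite mul1n.
    rewrite (bigD1 (Ordinal (top_lt w j))) //= eqxx big1 // => b /andP[_ /eqP bt].
    by apply/eqP; rewrite eqb0; apply/eqP => e; apply: bt; apply: val_inj.
  rewrite big1 // => b ab; apply/eqP; rewrite eqb0; apply/eqP => e.
  by move: h; rewrite -e ltnNge ab.
by rewrite !E /cum -!big_split; apply: eq_bigr => b _; exact: move_count.
Qed.

Lemma valid_move {n lam} (w : config n lam) j : (1 < n)%N -> valid_config w ->
  site_nonempty w j -> valid_config (move w j).
Proof.
move=> n1 vw ne; apply: (valid_cum w) => // a.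
have D (k : 'I_n) c : (\sum_i (i == k) * c = c)%N.
  by rewrite (bigD1 k) //= eqxx mul1n big1 ?addn0 // => i /negbTE ->.
apply: (@addIn (0 < cum w j a)%N).
rewrite -[in LHS](D (ordS j) (nat_of_bool _)) -[in RHS](D j (nat_of_bool _)) -!big_split /=.
by apply: eq_bigr => i _; rewrite cum_move.
Qed.

(** * Regrouping the particles of two sites, and its commutation with jumps *)

(* In [regroup p q j w], site [q] keeps its [j] strongest particles and site [p]
   receives the others. *)
Definition regroup {n lam} (p q : 'I_n) (j : nat) (w : config n lam) : config n lam :=
  let keep a := minn j (cum w q a) in
  let send a := (cum w p a + (cum w q a - keep a))%N in
  [ffun i => [ffun a : 'I_(nspec lam) =>
     if i == p then inord (send a - send a.+1)
     else if i == q then inord (keep a - keep a.+1)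
     else w i a]].

Lemma cum_regroup {n lam} (p q : 'I_n) j (w : config n lam) i a :
  p != q -> valid_config w ->
  cum (regroup p q j w) i a =
    if i == p then (cum w p a + (cum w q a - j))%N
    else if i == q then minn j (cum w q a) else cum w i a.
Proof.
move=> pq vw.
have [big|/ltnW small] := leqP (nspec lam) a.
  by rewrite !cum_big // minn0 !if_same.
pose F a := if i == p then (cum w p a + (cum w q a - j))%N
    else if i == q then minn j (cum w q a) else cum w i a.
apply: (cum_telescope _ _ F) => // [b c bc||b].
- have mono k : (cum w k c <= cum w k b)%N.
    rewrite /cum [leqRHS](bigID (fun d : 'I__ => (c <= d)%N)) /= -[leqLHS]addn0 leq_add //.
    rewrite leq_eqVlt; apply/orP; left; apply/eqP/eq_bigl => d.
    by case: leqP => h; rewrite ?andbF // (leq_trans bc).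
  have := mono p; have := mono q; have := mono i; rewrite /F.
  by case: (i == p); case: (i == q); lia.
- by rewrite /F !cum_big // minn0 !if_same.
(* Each new count of species [b] at [p] or [q] is at most the old joint count at the two sites,
   hence at most [size lam], and [inord] is exact. *)
have := valid_le w _ _ b vw pq; have := cum_rec w p b; have := cum_rec w q b.
have := cum_rec w i b.
rewrite /F !ffunE; case: (i == p); last case: (i == q); last by lia.
  by move=> ? ? ? ?; rewrite inordK; lia.
by move=> ? ? ? ?; rewrite inordK; lia.
Qed.

Lemma valid_regroup {n lam} (p q : 'I_n) j (w : config n lam) :
  p != q -> valid_config w -> valid_config (regroup p q j w).
Proof.
move=> pq vw; apply: (valid_cum w) => // a.
rewrite (bigD1 p) //= (bigD1 q) 1?eq_sym //= [RHS](bigD1 p) //= [in RHS](bigD1 q) 1?eq_sym //=.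
rewrite !cum_regroup // eqxx eq_sym (negbTE pq) eqxx !addnA; congr (_ + _)%N; first by lia.
by apply: eq_bigr => i /andP[ip iq]; rewrite cum_regroup // (negbTE ip) (negbTE iq).
Qed.

Lemma regroup_empty {n lam} (p q : 'I_n) j (w : config n lam) :
  p != q -> valid_config w -> ~~ site_nonempty w q -> regroup p q j w = w.
Proof.
move=> pq vw; rewrite nonempty_cum -eqn0Ngt => /eqP e0; apply: cum_inj => i a.
have qa : cum w q a = 0%N.
  apply/eqP; rewrite -leqn0 -e0 /cum [leqRHS](bigID (fun b : 'I__ => (a <= b)%N)) /=.
  by rewrite leq_addr.
rewrite cum_regroup // qa minn0 addn0.
by case: eqVneq => [->|_] //; case: eqVneq => [->|_].
Qed.

Lemma nonempty_regroup_snd {n lam} (p q : 'I_n) j (w : config n lam) :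
  p != q -> valid_config w ->
  site_nonempty (regroup p q j w) q = (0 < j)%N && site_nonempty w q.
Proof.
by move=> pq vw; rewrite !nonempty_cum cum_regroup // eq_sym (negbTE pq) eqxx leq_min.
Qed.

Lemma nonempty_regroup_fst {n lam} (p q : 'I_n) j (w : config n lam) :
  p != q -> valid_config w ->
  site_nonempty (regroup p q j w) p = site_nonempty w p || (j < cum w q 0)%N.
Proof.
by move=> pq vw; rewrite !nonempty_cum cum_regroup // eqxx addn_gt0 subn_gt0.
Qed.

Lemma nonempty_regroup_other {n lam} (p q i : 'I_n) j (w : config n lam) :
  p != q -> valid_config w -> i != p -> i != q ->
  site_nonempty (regroup p q j w) i = site_nonempty w i.
Proof.
by move=> pq vw ip iq; rewrite !nonempty_cum cum_regroup // (negbTE ip) (negbTE iq).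
Qed.

(** A particle coming from [i] may land at [p], where it simply joins those sent back, but never at
    [ordS p]. *)
Lemma regroup_move_other {n lam} (p i : 'I_n) j (w : config n lam) :
  (1 < n)%N -> valid_config w -> i != p -> i != ordS p -> site_nonempty w i ->
  regroup p (ordS p) j (move w i) = move (regroup p (ordS p) j w) i.
Proof.
move=> n1 vw ip iq ne.
have pq : p != ordS p by rewrite eq_sym ordS_neq.
have vs := valid_regroup p (ordS p) j w pq vw.
have nes : site_nonempty (regroup p (ordS p) j w) i by rewrite nonempty_regroup_other.
have qi : (ordS p == ordS i) = false by rewrite (inj_eq (@ordS_inj n)) eq_sym (negbTE ip).
have vm := valid_move w i n1 vw ne.
apply: cum_inj => k a; rewrite cum_regroup //.
have := cum_move w i k a n1 vw ne.
have := cum_move (regroup p (ordS p) j w) i k a n1 vs nes.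
rewrite !cum_regroup // (negbTE ip) (negbTE iq).
case: (eqVneq k p) => [->|kp].
  have := cum_move w i (ordS p) a n1 vw ne.
  rewrite qi !(eq_sym _ i) (negbTE ip) (negbTE iq) !mul0n !addn0 => ->.
  by case: (p == ordS i); rewrite ?mul0n ?mul1n ?addn0; clear; lia.
case: (eqVneq k (ordS p)) => [->|kq].
  by rewrite qi !(eq_sym _ i) (negbTE iq) !mul0n !addn0 => -> ->.
by case: (k == i); case: (k == ordS i); rewrite ?mul0n ?mul1n ?addn0; clear; lia.
Qed.

(** On both sides [ordS p] ends with its [j] strongest particles and the strongest among the top of
    [p] and the rest of [ordS p]. *)
Lemma regroup_move_fst {n lam} (p : 'I_n) j (w : config n lam) :
  (1 < n)%N -> valid_config w -> site_nonempty w p ->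
  regroup p (ordS p) j.+1 (move w p) = move (regroup p (ordS p) j w) p.
Proof.
move=> n1 vw ne.
have qp : (ordS p == p) = false by rewrite (negbTE (ordS_neq p n1)).
have pq : p != ordS p by rewrite eq_sym qp.
have vs := valid_regroup p (ordS p) j w pq vw.
have nes : site_nonempty (regroup p (ordS p) j w) p by rewrite nonempty_regroup_fst // ne.
have vm := valid_move w p n1 vw ne.
apply: cum_inj => k a; rewrite cum_regroup //.
have := cum_move (regroup p (ordS p) j w) p k a n1 vs nes.
have := cum_move w p k a n1 vw ne.
have := cum_move w p p a n1 vw ne.
have := cum_move w p (ordS p) a n1 vw ne.
rewrite !cum_regroup // !eqxx qp (negbTE pq).
case: (eqVneq k p) => [->|kp]; first by rewrite (negbTE pq); lia.
by case: (eqVneq k (ordS p)) => [->|kq]; lia.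
Qed.

(** With [j = 0] everything at [ordS p] returns to [p], including the particle that has just
    arrived. *)
Lemma regroup0_move {n lam} (p : 'I_n) (w : config n lam) :
  (1 < n)%N -> valid_config w -> site_nonempty w p ->
  regroup p (ordS p) 0 (move w p) = regroup p (ordS p) 0 w.
Proof.
move=> n1 vw ne.
have qp : (ordS p == p) = false by rewrite (negbTE (ordS_neq p n1)).
have pq : p != ordS p by rewrite eq_sym qp.
have vm := valid_move w p n1 vw ne.
apply: cum_inj => k a; rewrite !cum_regroup //.
have := cum_move w p k a n1 vw ne.
have := cum_move w p p a n1 vw ne.
have := cum_move w p (ordS p) a n1 vw ne.
rewrite !eqxx qp (negbTE pq).
case: (eqVneq k p) => [->|kp]; first by lia.
by case: (eqVneq k (ordS p)) => [->|kq]; lia.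
Qed.

(** Removing the strongest particle and keeping the next [j] is the same as keeping [j.+1] and
    removing the strongest. *)
Lemma regroup_move_snd {n lam} (p : 'I_n) j (w : config n lam) :
  (1 < n)%N -> ordS (ordS p) != p -> valid_config w -> site_nonempty w (ordS p) ->
  regroup p (ordS p) j (move w (ordS p)) = move (regroup p (ordS p) j.+1 w) (ordS p).
Proof.
move=> n1 rp vw ne.
have qp : (ordS p == p) = false by rewrite (negbTE (ordS_neq p n1)).
have pq : p != ordS p by rewrite eq_sym qp.
have pr : (p == ordS (ordS p)) = false by rewrite eq_sym (negbTE rp).
have qr : (ordS p == ordS (ordS p)) = false by rewrite eq_sym (negbTE (ordS_neq _ n1)).
have vs := valid_regroup p (ordS p) j.+1 w pq vw.
have nes : site_nonempty (regroup p (ordS p) j.+1 w) (ordS p) by rewrite nonempty_regroup_snd // ne.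
have vm := valid_move w _ n1 vw ne.
apply: cum_inj => k a; rewrite cum_regroup //.
have := cum_move (regroup p (ordS p) j.+1 w) _ k a n1 vs nes.
have := cum_move w (ordS p) k a n1 vw ne.
have := cum_move w (ordS p) p a n1 vw ne.
have := cum_move w (ordS p) (ordS p) a n1 vw ne.
rewrite !cum_regroup // !eqxx qp (negbTE pq) pr qr !mul0n !mul1n !addn0.
case: (eqVneq k p) => [->|kp].
  by rewrite (negbTE pq) pr !mul0n !addn0 => H -> _ ->; move: H; clear; lia.
case: (eqVneq k (ordS p)) => [->|kq].
  by rewrite qr !mul0n !mul1n !addn0 => H _ _; move: H; clear; lia.
by move=> _ _; case: (k == _); rewrite ?mul0n ?mul1n ?addn0; clear; lia.
Qed.

(** As [p] was empty, after the regrouping its strongest particle is number [j.+1] of [ordS p] in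
    order of strength, and the jump puts it back. *)
Lemma move_regroup_empty {n lam} (p : 'I_n) j (w : config n lam) :
  (1 < n)%N -> valid_config w -> ~~ site_nonempty w p -> (j < cum w (ordS p) 0)%N ->
  move (regroup p (ordS p) j w) p = regroup p (ordS p) j.+1 w.
Proof.
move=> n1 vw ne jk.
have qp : (ordS p == p) = false by rewrite (negbTE (ordS_neq p n1)).
have pq : p != ordS p by rewrite eq_sym qp.
have vs := valid_regroup p (ordS p) j w pq vw.
have nes : site_nonempty (regroup p (ordS p) j w) p by rewrite nonempty_regroup_fst // jk orbT.
have p0 a : cum w p a = 0%N.
  apply/eqP; rewrite eqn0Ngt; apply: contra ne; rewrite cum_gt0 => /existsP[b /andP[_ wb]].
  by apply/existsP; exists b.
apply: cum_inj => k a; rewrite cum_regroup //.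
have := cum_move (regroup p (ordS p) j w) p k a n1 vs nes.
rewrite !cum_regroup // !eqxx p0.
case: (eqVneq k p) => [->|kp]; first by rewrite (negbTE pq); lia.
by case: (eqVneq k (ordS p)) => [->|kq]; lia.
Qed.

(** * The intertwining kernel *)

(* The expectation of [g (min k G)] for [G] geometric with [P (G >= j) = r ^ j]. *)
Fixpoint trunc_geom {R : realType} (r : R) (k : nat) (g : nat -> R) : R :=
  if k is k'.+1 then (1 - r) * g 0%N + r * trunc_geom r k' (fun j => g j.+1) else g 0%N.

Lemma eq_trunc_geom {R : realType} (r : R) k g h : (forall j, (j <= k)%N -> g j = h j) ->
  trunc_geom r k g = trunc_geom r k h.
Proof.
elim: k g h => [|k IH] g h e /=; first exact: e.
by rewrite e // (IH _ (fun j => h j.+1)) // => j jk; exact: e.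
Qed.

Lemma trunc_geomZ {R : realType} (r c : R) k g :
  trunc_geom r k (fun j => c * g j) = c * trunc_geom r k g.
Proof. by elim: k g => [|k IH] g //=; rewrite IH; ring. Qed.

Lemma trunc_geomB {R : realType} (r : R) k g h :
  trunc_geom r k (fun j => g j - h j) = trunc_geom r k g - trunc_geom r k h.
Proof. by elim: k g h => [|k IH] g h //=; rewrite IH; ring. Qed.

Lemma trunc_geom_cst {R : realType} (r c : R) k : trunc_geom r k (fun=> c) = c.
Proof. by elim: k => [|k IH] //=; rewrite IH; ring. Qed.

Lemma trunc_geom_sum {R : realType} (r : R) k (I : finType) (F : I -> nat -> R) :
  trunc_geom r k (fun j => \sum_i F i j) = \sum_i trunc_geom r k (F i).
Proof.
elim: k F => [|k IH] F //=; rewrite IH !mulr_sumr -big_split /=.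
by apply: eq_bigr.
Qed.

(** In terms of the geometric variable G, the values 1 + min(k, G) and min(k + 1, G) differ only
    when G <= k, and are then G + 1 and G. *)
Lemma trunc_geom_diff {R : realType} (r : R) k g :
  trunc_geom r k.+1 (fun j => (j < k.+1)%N%:R * (g j.+1 - g j)) =
  trunc_geom r k (fun j => g j.+1) - trunc_geom r k.+1 g.
Proof.
elim: k g => [|k IH] g; first by rewrite /=; ring.
have := IH (fun j => g j.+1) => /= {}IH.
by rewrite [in LHS]/= IH /=; ring.
Qed.

(* The two balance identities at sites [p] and [q = p + 1], whose rates are [a]
   and [b] on the right and exchanged on the left; [g j], [h j] and [e j] stand for
   [f (regroup j w)], [f (regroup j (move w p))] and [f (regroup j (move w q))]. *)
Lemma balance_nonempty {R : realType} (a b : R) k (g h e : nat -> R) : b != 0 -> h 0%N = g 0%N ->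
  b * (trunc_geom (a / b) k.+1 h - trunc_geom (a / b) k g) +
  (0 < k)%N%:R * (a * (trunc_geom (a / b) k.-1 e - trunc_geom (a / b) k g)) =
  trunc_geom (a / b) k (fun j => a * (h j.+1 - g j)) +
  trunc_geom (a / b) k (fun j => (0 < j)%N%:R * (b * (e j.-1 - g j))).
Proof.
move=> b0 hg; rewrite trunc_geomZ trunc_geomB.
case: k => [|k]; first by rewrite /= hg; field.
(* The value [j = 0] contributes nothing, so the last term is [a / b] times a truncated mean of the
   shifted function, and [b * (a / b) = a]. *)
rewrite [X in _ = _ + X]/= mul0r mulr0 add0r.
under [X in _ = _ + _ * X]eq_trunc_geom do rewrite /= mul1r.
rewrite trunc_geomZ trunc_geomB /= hg; by field.
Qed.

Lemma balance_empty {R : realType} (a b : R) k (g e : nat -> R) : b != 0 ->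
  (0 < k)%N%:R * (a * (trunc_geom (a / b) k.-1 e - trunc_geom (a / b) k g)) =
  trunc_geom (a / b) k (fun j => (j < k)%N%:R * (a * (g j.+1 - g j))) +
  trunc_geom (a / b) k (fun j => (0 < j)%N%:R * (b * (e j.-1 - g j))).
Proof.
move=> b0; case: k => [|k]; first by rewrite /= !mul0r addr0.
under [X in _ = X + _]eq_trunc_geom do rewrite mulrCA.
rewrite trunc_geomZ trunc_geom_diff.
rewrite [X in _ = _ + X]/= mul0r mulr0 add0r.
under [X in _ = _ + _ * X]eq_trunc_geom do rewrite /= mul1r.
by rewrite trunc_geomZ trunc_geomB /=; field.
Qed.

Definition jump {R : realType} {n lam} (x : 'I_n -> R) (f : config n lam -> R) w i : R :=
  (site_nonempty w i)%:R * ((x i)^-1 * (f (move w i) - f w)).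

Definition gen_op {R : realType} {n lam} (x : 'I_n -> R) (f : config n lam -> R) w : R :=
  \sum_i jump x f w i.

(** The kernel Lambda acting on functions. *)
Definition mix {R : realType} {n lam} (x : 'I_n -> R) p (f : config n lam -> R) w : R :=
  trunc_geom ((x p)^-1 / (x (ordS p))^-1) (cum w (ordS p) 0)
    (fun j => f (regroup p (ordS p) j w)).

(** The jump does not alter the number of particles at [ordS p], so the same truncated geometric law
    is used before and after it. *)
Lemma jump_mix_other {R : realType} {n lam} (x : 'I_n -> R) p i (f : config n lam -> R) w :
  (1 < n)%N -> valid_config w -> i != p -> i != ordS p ->
  jump x (mix x p f) w i = mix x p (fun w => jump x f w i) w.
Proof.
move=> n1 vw ip iq; have pq : p != ordS p by rewrite eq_sym ordS_neq.
rewrite /jump /mix.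
under [RHS]eq_trunc_geom do rewrite nonempty_regroup_other //.
rewrite trunc_geomZ; case: (boolP (site_nonempty w i)) => ne; last by rewrite !mul0r.
rewrite !mul1r trunc_geomZ trunc_geomB; congr (_ * (_ - _)).
have -> : cum (move w i) (ordS p) 0 = cum w (ordS p) 0.
  have := cum_move w i (ordS p) 0 n1 vw ne.
  by rewrite eq_sym (negbTE iq) (inj_eq (@ordS_inj n)) eq_sym (negbTE ip) !addn0.
by apply: eq_trunc_geom => j _; rewrite regroup_move_other.
Qed.

(** With the rates exchanged, the two sites do not satisfy the relation separately in general; only
    their sum does, by the two balance identities. *)
Lemma jump_mix_pair {R : realType} {n lam} (x x' : 'I_n -> R) p (f : config n lam -> R) w :
  (1 < n)%N -> ordS (ordS p) != p -> valid_config w -> 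
  x (ordS p) != 0 -> x' p = x (ordS p) -> x' (ordS p) = x p ->
  jump x' (mix x p f) w p + jump x' (mix x p f) w (ordS p) =
  mix x p (fun w => jump x f w p) w + mix x p (fun w => jump x f w (ordS p)) w.
Proof.
move=> n1 rp vw xq0 x'p x'q; have pq : p != ordS p by rewrite eq_sym ordS_neq.
rewrite /jump /mix x'p x'q.
set a := (x p)^-1; set b := (x (ordS p))^-1; set q := ordS p.
have b0 : b != 0 by rewrite invr_neq0.
set k := cum w q 0.
pose g j := f (regroup p q j w); pose e j := f (regroup p q j (move w q)).
have neq : site_nonempty w q = (0 < k)%N by rewrite nonempty_cum.
have -> : (site_nonempty w q)%:R * (a * (trunc_geom (a / b) (cum (move w q) q 0)
    (fun j => f (regroup p q j (move w q))) - trunc_geom (a / b) k g)) =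
   (0 < k)%N%:R * (a * (trunc_geom (a / b) k.-1 e - trunc_geom (a / b) k g)).
  rewrite neq; case: ltnP => k0; last by rewrite !mul0r.
  rewrite -neq in k0; congr (_ * (_ * (trunc_geom _ _ _ - _))).
  have := cum_move w q q 0 n1 vw k0.
  rewrite eqxx eq_sym (negbTE (ordS_neq _ n1)) -nonempty_cum k0 mul1n addn0 addn1.
  by rewrite /k => <-.
have -> : trunc_geom (a / b) k (fun j => (site_nonempty (regroup p q j w) q)%:R *
    (b * (f (move (regroup p q j w) q) - f (regroup p q j w)))) =
  trunc_geom (a / b) k (fun j => (0 < j)%N%:R * (b * (e j.-1 - g j))).
  apply: eq_trunc_geom => -[|j] jk; rewrite nonempty_regroup_snd // ?mul0r //= neq.
  by rewrite (leq_trans _ jk) // /e regroup_move_snd // neq (leq_trans _ jk).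
case: (boolP (site_nonempty w p)) => ne; last first.
  (* With [p] empty in [w], regrouping makes it nonempty exactly when [j < k], which is the
     indicator in [balance_empty]. *)
  rewrite mul0r add0r (balance_empty _ _ _ g) //; congr (_ + _).
  apply: eq_trunc_geom => j jk; rewrite nonempty_regroup_fst // (negbTE ne) orFb.
  case: ltnP => jk'; last by rewrite !mul0r.
  by rewrite move_regroup_empty.
pose h j := f (regroup p q j (move w p)).
rewrite mul1r.
have -> : cum (move w p) q 0 = k.+1.
  have := cum_move w p q 0 n1 vw ne.
  by rewrite eqxx eq_sym (negbTE pq) addn0 -nonempty_cum ne mul1n addn1.
rewrite (balance_nonempty _ _ _ g h) //; last by rewrite /h regroup0_move.
congr (_ + _); apply: eq_trunc_geom => j jk.
by rewrite nonempty_regroup_fst // ne mul1r /h regroup_move_fst.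
Qed.

Lemma gen_op_mix {R : realType} {n lam} (x : 'I_n -> R) p (f : config n lam -> R) w :
  (1 < n)%N -> ordS (ordS p) != p -> x (ordS p) != 0 -> valid_config w ->
  gen_op (fun i => x (tperm p (ordS p) i)) (mix x p f) w = mix x p (gen_op x f) w.
Proof.
move=> n1 rp xq vw; have pq : p != ordS p by rewrite eq_sym ordS_neq.
rewrite {1}/gen_op [RHS]/mix /gen_op trunc_geom_sum.
rewrite (bigD1 p) //= (bigD1 (ordS p)) 1?eq_sym //=.
rewrite [RHS](bigD1 p) //= [in RHS](bigD1 (ordS p)) 1?eq_sym //= !addrA.
rewrite (jump_mix_pair x) ?tpermL ?tpermR //; congr (_ + _).
apply: eq_bigr => i /andP[ip iq].
rewrite (_ : jump _ _ _ i = jump x (mix x p f) w i); first exact: jump_mix_other.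
by rewrite /jump tpermD // eq_sym.
Qed.

(** * Transition probabilities *)

Local Open Scope classical_set_scope.

Lemma sum_delta {R : realType} {T : finType} (f : T -> R) w :
  \sum_v (w == v)%:R * f v = f w.
Proof.
rewrite (bigD1 w) //= eqxx mul1r big1 ?addr0 // => v.
by rewrite eq_sym => /negbTE ->; rewrite mul0r.
Qed.

Lemma gen_op_sum {R : realType} {n lam} (x : 'I_n -> R) (f : config n lam -> R) w :
  \sum_v gen x w v * f v = gen_op x f w.
Proof.
rewrite /gen_op [RHS](eq_bigr (fun i => if site_nonempty w i then
    (x i)^-1 * (f (move w i) - f w) else 0)); last first.
  by move=> i _; rewrite /jump; case: ifP; rewrite (mul1r, mul0r).
rewrite -big_mkcond /=; under eq_bigr do rewrite mulr_suml.
rewrite exchange_big /=; apply: eq_bigr => i _.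
under eq_bigr do rewrite -mulrA mulrBl.
by rewrite -mulr_sumr sumrB !sum_delta.
Qed.

Lemma gen_powE {R : realType} {n lam} (x : 'I_n -> R) k (f : config n lam -> R) w :
  \sum_v gen_pow x k w v * f v = iter k (gen_op x) f w.
Proof.
elim: k w => [|k IH] w /=; first exact: sum_delta.
under eq_bigr do rewrite mulr_suml.
rewrite exchange_big /= -gen_op_sum; apply: eq_bigr => u _.
by rewrite -IH mulr_sumr; apply: eq_bigr => v _; rewrite mulrA.
Qed.

(** The sum of the absolute values of all entries of the generator dominates every row sum, which is
    what the induction uses. *)
Lemma gen_pow_bound {R : realType} {n lam} (x : 'I_n -> R) k (w v : config n lam) :
  `|gen_pow x k w v| <= (\sum_(u : config n lam) \sum_t `|gen x u t|) ^+ k.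
Proof.
elim: k w => [|k IH] w /=; first by case: (w == v); rewrite expr0 ?normr1 ?normr0.
apply: le_trans (ler_norm_sum _ _ _) _; rewrite exprS.
apply: (@le_trans _ _ (\sum_t `|gen x w t| * (\sum_(u : config n lam) \sum_t `|gen x u t|) ^+ k)).
  by apply: ler_sum => t _; rewrite normrM ler_wpM2l.
rewrite -mulr_suml ler_wpM2r ?exprn_ge0 ?sumr_ge0 // => [u _|].
  by rewrite sumr_ge0.
rewrite [leRHS](bigD1 w) //= lerDl sumr_ge0 // => u _; exact: sumr_ge0.
Qed.

(** [trans] is defined as a [limn], which is informative only once convergence is known; the
    exponential series dominates. *)
Lemma trans_is_cvg {R : realType} {n lam} (x : 'I_n -> R) d (w v : config n lam) :
  (fun N => \sum_(k < N) (d ^+ k / (k`!)%:R) * gen_pow x k w v) @ \oo --> trans x d w v.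
Proof.
pose c k := d ^+ k / (k`!)%:R * gen_pow x k w v.
rewrite /trans (_ : (fun N => _) = series c); last first.
  by apply/funext => N; rewrite /series /= big_mkord.
apply: normed_cvg.
pose M : R := \sum_(u : config n lam) \sum_t `|gen x u t|.
apply: (@series_le_cvg _ _ (exp_coeff (`|d| * M))) => [k|k|k|].
- exact: normr_ge0.
- by rewrite exp_coeff_ge0 // mulr_ge0 // sumr_ge0 // => u _; exact: sumr_ge0.
- rewrite /c /exp_coeff /= normrM normf_div normrX normr_nat exprMn [leRHS]mulrAC.
  by apply: ler_wpM2l; [rewrite divr_ge0 ?exprn_ge0|exact: gen_pow_bound].
exact: is_cvg_series_exp_coeff.
Qed.

Definition trans_op {R : realType} {n lam} (x : 'I_n -> R) d (f : config n lam -> R) w : R :=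
  \sum_v trans x d w v * f v.

Lemma trans_op_cvg {R : realType} {n lam} (x : 'I_n -> R) d (f : config n lam -> R) w :
  (fun N => \sum_(k < N) (d ^+ k / (k`!)%:R) * iter k (gen_op x) f w) @ \oo --> trans_op x d f w.
Proof.
rewrite (_ : (fun N => _) = (fun N => \sum_v
    (\sum_(k < N) (d ^+ k / (k`!)%:R) * gen_pow x k w v) * f v)); last first.
  apply/funext => N; under [RHS]eq_bigr do rewrite mulr_suml.
  rewrite exchange_big /=; apply: eq_bigr => k _.
  by rewrite -gen_powE mulr_sumr; apply: eq_bigr => v _; rewrite mulrA.
apply: cvg_big => [|v _]; [exact: add_continuous|apply: cvgMr_tmp]; exact: trans_is_cvg.
Qed.

Lemma trunc_geom_cvg {R : realType} (r : R) k (u : nat -> nat -> R) (l : nat -> R) :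
  (forall j, (fun N => u N j) @ \oo --> l j) ->
  (fun N => trunc_geom r k (u N)) @ \oo --> trunc_geom r k l.
Proof.
elim: k u l => [|k IH] u l ul /=; first exact: ul.
apply: cvgD; apply: cvgMl_tmp; first exact: ul.
by apply: (IH (fun N j => u N j.+1)) => j; exact: ul.
Qed.

(** Jumps preserve validity, so values at invalid configurations never enter. This matters because
    the intertwining is established at valid ones only. *)
Lemma eq_iter_gen_op {R : realType} {n lam} (x : 'I_n -> R) k (f g : config n lam -> R) :
  (1 < n)%N -> (forall w, valid_config w -> f w = g w) ->
  forall w, valid_config w -> iter k (gen_op x) f w = iter k (gen_op x) g w.
Proof.
move=> n1 fg; elim: k => [|k IH] w vw /=; first exact: fg.
apply: eq_bigr => i _; rewrite /jump; case: (boolP (site_nonempty w i)) => ne.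
  by rewrite !IH //; exact: valid_move.
by rewrite !mul0r.
Qed.

Lemma eq_trans_op {R : realType} {n lam} (x : 'I_n -> R) d (f g : config n lam -> R) w :
  (1 < n)%N -> (forall w, valid_config w -> f w = g w) -> valid_config w ->
  trans_op x d f w = trans_op x d g w.
Proof.
move=> n1 fg vw; have := trans_op_cvg x d f w; have := trans_op_cvg x d g w.
under eq_cvg do under eq_bigr do rewrite -(eq_iter_gen_op x _ f g n1 fg w vw).
by move=> gl fl; apply: (@cvg_unique _ (@norm_hausdorff _ _)) gl.
Qed.

(** The intertwining passes from the generator to its powers, hence to the partial sums of the
    exponential, and to the limit because [mix] is a finite linear combination. *)
Lemma trans_op_mix {R : realType} {n lam} (x : 'I_n -> R) p d (f : config n lam -> R) w :
  (1 < n)%N -> ordS (ordS p) != p -> x (ordS p) != 0 -> valid_config w ->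
  trans_op (fun i => x (tperm p (ordS p) i)) d (mix x p f) w = mix x p (trans_op x d f) w.
Proof.
move=> n1 rp xq vw.
pose x' i := x (tperm p (ordS p) i).
have mix_iter k v : valid_config v ->
    iter k (gen_op x') (mix x p f) v = mix x p (iter k (gen_op x) f) v.
  elim: k f v => [|k IH] g v vv //=; rewrite -gen_op_mix //.
  exact: (eq_iter_gen_op x' 1 (iter k (gen_op x') (mix x p g))
    (mix x p (iter k (gen_op x) g)) n1 (IH g)).
have lr := trunc_geom_cvg ((x p)^-1 / (x (ordS p))^-1) (cum w (ordS p) 0) _ _
  (fun j => trans_op_cvg x d f (regroup p (ordS p) j w)).
have ll := trans_op_cvg x' d (mix x p f) w.
apply: (@cvg_unique _ (@norm_hausdorff _ _)) ll _.
apply: cvg_trans lr; apply: near_eq_cvg; near=> N.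
rewrite trunc_geom_sum; apply: eq_bigr => k _.
by rewrite mix_iter // trunc_geomZ.
Unshelve. all: by end_near. Qed.

(** * Finite-dimensional distributions of the restricted path *)

Lemma fdd_cons {R : realType} {n lam} (x : 'I_n -> R) l d ds y ys (w : config n lam) :
  fdd x l (d :: ds) (y :: ys) w =
  trans_op x d (fun v => (Defs.restrict l v == y)%:R * fdd x l ds ys v) w.
Proof.
rewrite /= big_mkcond; apply: eq_bigr => v _.
by case: eqP => _; rewrite ?mul1r ?mul0r ?mulr0.
Qed.

Lemma restrict_regroup {n lam} (p q : 'I_n) l j (w : config n lam) :
  (l <= p)%N -> (l <= q)%N -> Defs.restrict l (regroup p q j w) = Defs.restrict l w.
Proof.
move=> lp lq; apply/ffunP => i; rewrite !ffunE; case: ltnP => // il.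
apply/ffunP => a; rewrite ffunE.
have /negbTE -> : i != p by apply: contraTneq il => ->; rewrite -leqNgt.
by have /negbTE -> : i != q by apply: contraTneq il => ->; rewrite -leqNgt.
Qed.

Lemma val_ordS {n} (p : 'I_n) : (p.+1 < n)%N -> ordS p = p.+1 :> nat.
Proof. by move=> pn /=; rewrite modn_small. Qed.

Lemma ordSS_neq {n} (p : 'I_n) : (2 < n)%N -> ordS (ordS p) != p.
Proof.
move=> n2; apply/eqP => /(congr1 val) /=.
rewrite -addn1 modnDml addn1 => e; have pn0 := ltn_ord p.
have [pn|pn] := ltnP p.+2 n; first by move: e; rewrite modn_small //; lia.
move: e; rewrite -(subnK pn) modnDr modn_small; lia.
Qed.

(** Induction on the observation times: Lambda commutes with each transition and, as regrouping
    leaves the window unchanged, with each observation. When no observation remains, both sides are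
    1 because Lambda has total mass 1. *)
Lemma fdd_mix {R : realType} {n lam} (x : 'I_n -> R) l (p : 'I_n) ds ys (w : config n lam) :
  (2 < n)%N -> (l <= p)%N -> (p.+1 < n)%N -> x (ordS p) != 0 -> valid_config w ->
  fdd (fun i => x (tperm p (ordS p) i)) l ds ys w = mix x p (fdd x l ds ys) w.
Proof.
move=> n2 lp pn xq; have n1 : (1 < n)%N by exact: ltnW.
have lq : (l <= ordS p)%N by rewrite val_ordS // leqW.
elim: ds ys w => [|d ds IH] [|y ys] w vw; rewrite ?[RHS]trunc_geom_cst //.
rewrite fdd_cons.
transitivity (mix x p (trans_op x d (fun v => (Defs.restrict l v == y)%:R * fdd x l ds ys v)) w);
  last by apply: eq_trunc_geom => j _; rewrite fdd_cons.
rewrite -trans_op_mix ?ordSS_neq //; apply: eq_trans_op => // v vv.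
rewrite IH // /mix -trunc_geomZ; apply: eq_trunc_geom => j _.
by rewrite restrict_regroup.
Qed.

Lemma fdd_swap {R : realType} {n lam} (x : 'I_n -> R) l (p : 'I_n) ds ys (w : config n lam) :
  (2 < n)%N -> (l <= p)%N -> (p.+1 < n)%N -> x (ordS p) != 0 -> valid_config w ->
  ~~ site_nonempty w (ordS p) ->
  fdd (fun i => x (tperm p (ordS p) i)) l ds ys w = fdd x l ds ys w.
Proof.
move=> n2 lp pn xq vw e; rewrite fdd_mix // /mix.
move: (e); rewrite nonempty_cum -eqn0Ngt => /eqP -> /=.
by rewrite regroup_empty // eq_sym ordS_neq // ltnW.
Qed.

(** * From adjacent transpositions to arbitrary permutations *)

(* Adjacent transpositions generate the permutations supported in {l, ..., n - 1}. *)
Lemma adjacent_invariance {n} {T U : Type} (D : ('I_n -> T) -> Prop) (P : ('I_n -> T) -> U) l :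
  (forall x (s : {perm 'I_n}), D x -> D (fun i => x (s i))) ->
  (forall x (p : 'I_n), D x -> (l <= p)%N -> (p.+1 < n)%N ->
     P (fun i => x (tperm p (ordS p) i)) = P x) ->
  forall (s : {perm 'I_n}) x, (forall i : 'I_n, (i < l)%N -> s i = i) -> D x ->
  P (fun i => x (s i)) = P x.
Proof.
move=> DP adj.
pose good s := forall x, D x -> P (fun i => x (s i)) = P x.
have goodM (s t : {perm 'I_n}) : good s -> good t -> good (s * t)%g.
  move=> gs gt x Dx; rewrite -(gt x) // -(gs (fun i => x (t i))); last exact: DP.
  by congr P; apply/funext => i; rewrite permM.
have good_tperm k (i j : 'I_n) : (l <= i)%N -> (j = i + k.+1 :> nat)%N -> good (tperm i j).
  elim: k j => [|k IH] j li ej.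
    have ji : j = ordS i.
      by apply: val_inj; have := ltn_ord j; rewrite /= ej addn1 => jn; rewrite modn_small.
    by rewrite ji => x Dx; apply: adj => //; have := ltn_ord j; lia.
  have jn := ltn_ord j; have j'n : (i + k.+1 < n)%N by lia.
  pose j' := Ordinal j'n; have jS : j = ordS j'.
    by apply: val_inj; rewrite /= modn_small; lia.
  (* Conjugating by the adjacent transposition of [j'] and [j] shortens the distance by one. *)
  have -> : tperm i j = (tperm i j' ^ tperm j' j)%g.
    by rewrite tpermJ tpermL tpermD //; apply/eqP => /(congr1 val) /=; lia.
  have gj : good (tperm j' j) by rewrite jS => x Dx; apply: adj => //=; lia.
  by rewrite /conjg tpermV; apply: (goodM _ _ gj (goodM _ _ _ gj)); apply: IH.
move=> s x fs; apply: (_ : good s) => {x}.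
(* Induction on the number of points moved by [s]. *)
have [m] := ubnP #|[pred i | s i != i]|; elim: m s fs => // m IH s fs sm.
have [/existsP[i si]|/existsPn fix_s] := boolP [exists i, s i != i]; last first.
  move=> x _; congr P; apply/funext => i.
  by have /negPn/eqP -> := fix_s i.
have ge_l j : s j != j -> (l <= j)%N.
  by apply: contraNleq => jl; rewrite fs.
have ssi : s (s i) != s i by rewrite (inj_eq perm_inj).
(* Products of permutations act from left to right, so the second factor fixes [s i] as well as
   every fixed point of [s]: it moves fewer points. *)
have -> : s = (tperm i (s i) * (tperm i (s i) * s))%g by rewrite mulgA tperm2 mul1g.
apply: goodM.
  have [li lsi] := (ge_l _ si, ge_l _ ssi).
  have [lt|lt|/val_inj e] := ltngtP i (s i); last by rewrite -e eqxx in si.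
    by apply: (good_tperm (s i - i).-1) => //; lia.
  by rewrite tpermC; apply: (good_tperm (i - s i).-1) => //; lia.
apply: IH => [j jl|].
  rewrite permM tpermD ?(fs j) //.
    by apply: contraTneq jl => <-; rewrite -leqNgt ge_l.
  by apply: contraTneq jl => <-; rewrite -leqNgt ge_l.
apply: (leq_trans (n := #|[pred i | s i != i]|)); last by rewrite -ltnS.
apply: proper_card; apply/properP; split; last first.
  by exists (s i); rewrite !inE // permM tpermR eqxx.
apply/fintype.subsetP => j; rewrite !inE permM.
by case: tpermP => [->|->|] //; rewrite eqxx.
Qed.

Theorem theorem7 (R : realType) (n l : nat) (lam : seq nat) (x : 'I_n -> R)
  (sigma : {perm 'I_n}) (w0 : config n lam)
  (ds : seq R) (ys : seq (config n lam)) :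
  (3 <= n)%N -> (1 < l)%N -> (l < n)%N ->
  is_partition lam ->
  (forall i, 0 < x i) ->
  valid_config w0 ->
  (forall i : 'I_n, (l <= i)%N -> ~~ site_nonempty w0 i) ->
  (forall i : 'I_n, (i < l)%N -> sigma i = i) ->
  all (fun d => 0 < d) ds ->
  size ds = size ys ->
  fdd (fun i => x (sigma i)) l ds ys w0 = fdd x l ds ys w0.
Proof.
move=> n3 _ _ _ x0 vw emp fs _ _.
(* Positivity is the property carried along: permuting parameters preserves it, and it provides the
   nonzero parameter needed for each swap. *)
apply: (adjacent_invariance (fun x : 'I_n -> R => forall i, 0 < x i)
  (fun x => fdd x l ds ys w0) l _ _ sigma x fs x0) => [y s y0 i|y p y0 lp pn]; first exact: y0.
by apply: fdd_swap => //; [rewrite gt_eqF|apply: emp; rewrite val_ordS // leqW].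
Qed.
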